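(* Let $\mathcal{S}\subseteq\mathcal{B}(H)$ and $\mathcal{T}\subseteq\mathcal{B}(K)$ be non-commutative graphs ($H,K$ finite dimensional Hilbert spaces). The following are equivalent: there is a bicohomomorphism between $\mathcal{S}$ and $\mathcal{T}$; $\mathcal{S}$ and $\mathcal{T}$ are (concretely) bihomomorphically equivalent; $\mathcal{S}$ and $\mathcal{T}$ are TRO-equivalent.
   Context: A non-commutative graph is an operator system $\mathcal{S}\subseteq\mathcal{B}(H)$ with $H$ finite dimensional, i.e. a selfadjoint subspace containing $I_H$. A cohomomorphism from $\mathcal{T}\subseteq\mathcal{B}(K)$ to $\mathcal{S}\subseteq\mathcal{B}(H)$ is a unital completely positive map $\Phi:\mathcal{B}(K)\to\mathcal{B}(H)$ admitting a Kraus representation $\Phi(T)=\sum_{i=1}^rA_i^*TA_i$ with $A_i\in\mathcal{B}(H,K)$ and $A_i^*\mathcal{T}A_j\subseteq\mathcal{S}$ for all $i,j\in\{1,\dots,r\}$. A bicohomomorphism between $\mathcal{S}$ and $\mathcal{T}$ consists of a cohomomorphism from $\mathcal{T}$ to $\mathcal{S}$ and a cohomomorphism from $\mathcal{S}$ to $\mathcal{T}$ with such Kraus representations induced by $\{A_i\}_{i=1}^r$ and $\{B_j^*\}_{j=1}^{r'}$ (with $A_i,B_j\in\mathcal{B}(H,K)$), respectively, such that $\mathrm{span}\{A_i\}_{i=1}^{r}=\mathrm{span}\{B_j\}_{j=1}^{r'}$. A subspace $\mathcal{X}\subseteq\mathcal{B}(H,K)$ is non-degenerate if $I_H\in\mathrm{span}\,\mathcal{X}^*\mathcal{X}$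 and $I_K\in\mathrm{span}\,\mathcal{X}\mathcal{X}^*$. $\mathcal{S}$ and $\mathcal{T}$ are (concretely) bihomomorphically equivalent if there is a non-degenerate subspace $\mathcal{X}\subseteq\mathcal{B}(H,K)$ with $\mathcal{X}^*\mathcal{T}\mathcal{X}\subseteq\mathcal{S}$ and $\mathcal{X}\mathcal{S}\mathcal{X}^*\subseteq\mathcal{T}$. They are TRO-equivalent if such an $\mathcal{X}$ can be chosen to be a TRO, i.e. with $\mathcal{X}\mathcal{X}^*\mathcal{X}\subseteq\mathcal{X}$. *)

(* Defs.v *)
From mathcomp Require Export all_boot all_order all_algebra.
From mathcomp Require Export reals.
From mathcomp Require Export complex.

Set Implicit Arguments.
Unset Strict Implicit.
Unset Printing Implicit Defensive.

Import Order.TTheory GRing.Theory Num.Theory.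
Local Open Scope ring_scope.
Local Open Scope sesquilinear_scope.

(* Finite-dimensional Hilbert spaces are the spaces C^n of column vectors with
   the standard inner product, so that, with H = C^n and K = C^m, B(H) is
   'M[C]_n, B(H, K) is 'M[C]_(m, n) and the adjoint is the conjugate transpose
   A^t*. *)

(* The linear span of an arbitrary, possibly infinite, set P of vectors. *)
Definition in_span (F : fieldType) (V : vectType F) (P : V -> Prop) (v : V) :
    Prop :=
  exists2 s : seq V, (forall x, x \in s -> P x) & v \in <<s>>%VS.

Section NoncommutativeGraphs.

Variable C : numClosedFieldType.

Definition noncommutative_graph n (S : {vspace 'M[C]_n}) : Prop :=
  1%:M \in S /\ (forall M, M \in S -> M^t* \in S).

(* In a numClosedFieldType, 0 <= z entails that z is real. *)
Definition positive_operator n (M : 'M[C]_n) : Prop :=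
  forall x : 'cV[C]_n, 0 <= (x^t* *m M *m x) 0 0.

Definition completely_positive m n (Phi : {linear 'M[C]_m -> 'M[C]_n}) : Prop :=
  forall (k : nat) (T : 'I_k -> 'I_k -> 'M[C]_m),
    positive_operator (\mxblock_(i < k, j < k) T i j) ->
    positive_operator (\mxblock_(i < k, j < k) Phi (T i j)).

Section TwoGraphs.

Variables n m : nat.

Definition cohomomorphism_via (T : {vspace 'M[C]_m}) (S : {vspace 'M[C]_n})
    (Phi : {linear 'M[C]_m -> 'M[C]_n}) r (A : 'I_r -> 'M[C]_(m, n)) : Prop :=
  [/\ Phi 1%:M = 1%:M,
      completely_positive Phi,
      forall M, Phi M = \sum_(i < r) (A i)^t* *m M *m A i
    & forall i j M, M \in T -> (A i)^t* *m M *m A j \in S].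

End TwoGraphs.

Section Equivalences.

Variables n m : nat.
Variables (S : {vspace 'M[C]_n}) (T : {vspace 'M[C]_m}).

Definition bicohomomorphic : Prop :=
  exists (Phi : {linear 'M[C]_m -> 'M[C]_n})
         (Psi : {linear 'M[C]_n -> 'M[C]_m})
         (r r' : nat)
         (A : 'I_r -> 'M[C]_(m, n)) (B : 'I_r' -> 'M[C]_(m, n)),
    [/\ cohomomorphism_via T S Phi A,
        cohomomorphism_via S T Psi (fun j => (B j)^t*)
      & <<codom A>>%VS = <<codom B>>%VS].

Definition nondegenerate_subspace (X : {vspace 'M[C]_(m, n)}) : Prop :=
  in_span (fun M : 'M[C]_n =>
    exists a b, [/\ a \in X, b \in X & M = a^t* *m b]) 1%:M /\
  in_span (fun M : 'M[C]_m =>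
    exists a b, [/\ a \in X, b \in X & M = a *m b^t*]) 1%:M.

Definition is_TRO (X : {vspace 'M[C]_(m, n)}) : Prop :=
  forall a b c, a \in X -> b \in X -> c \in X -> a *m b^t* *m c \in X.

Definition bihom_implementing (X : {vspace 'M[C]_(m, n)}) : Prop :=
  [/\ nondegenerate_subspace X,
      forall a b t, a \in X -> b \in X -> t \in T -> a^t* *m t *m b \in S
    & forall a b s, a \in X -> b \in X -> s \in S -> a *m s *m b^t* \in T].

Definition bihomomorphically_equivalent : Prop :=
  exists X : {vspace 'M[C]_(m, n)}, bihom_implementing X.

Definition TRO_equivalent : Prop :=
  exists2 X : {vspace 'M[C]_(m, n)}, bihom_implementing X & is_TRO X.

End Equivalences.

End NoncommutativeGraphs.

(* Main.v *)
(** If [X] implements a bihomomorphic equivalence, then so does the span of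
    [X X^* X], and it contains [X] because [I] lies in the span of [X^* X];
    hence an implementing space of maximal dimension is a TRO.  If a
    non-degenerate [X] is a TRO with basis [x_i], then [P = \sum_i x_i^* x_i] is
    positive definite and, [P^(-1/2)] being a polynomial in [P], the operators
    [x_i P^(-1/2)] lie in [X]; they span [X] and are the Kraus operators of a
    unital map.  Conversely, the span of the Kraus operators of a
    bicohomomorphism implements a bihomomorphic equivalence. *)

Require Import Defs.
From HB Require Import structures.

Set Implicit Arguments.
Unset Strict Implicit.
Unset Printing Implicit Defensive.

Import Order.TTheory GRing.Theory Num.Theory.
Local Open Scope ring_scope.
Local Open Scope sesquilinear_scope.

(** * Induction over linear spans *)

Section SpanInduction.

Variables (F : fieldType) (V : vectType F) (Q : V -> Prop).
Hypotheses (Q0 : Q 0) (Qlin : forall a u v, Q u -> Q v -> Q (a *: u + v)).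

Lemma span_ind (s : seq V) :
  (forall x, x \in s -> Q x) -> forall v, v \in <<s>>%VS -> Q v.
Proof.
move=> Qs v /(@coord_span _ _ _ (in_tuple s)) ->.
elim/big_ind: _ => [//|x y Qx Qy|i _]; first by rewrite -[x]scale1r; apply: Qlin.
by rewrite -[_ *: _]addr0; apply: Qlin => //; apply/Qs/mem_nth.
Qed.

Lemma vbasis_ind (U : {vspace V}) :
  (forall x, x \in vbasis U -> Q x) -> forall v, v \in U -> Q v.
Proof. by move=> QU v; rewrite -{1}(span_basis (vbasisP U)); apply: span_ind. Qed.

Lemma in_span_ind (P : V -> Prop) :
  (forall x, P x -> Q x) -> forall v, in_span P v -> Q v.
Proof. by move=> PQ v [s sP]; apply: span_ind => x /sP; apply: PQ. Qed.

End SpanInduction.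

(** Newton interpolation: a new node [y] is corrected by a multiple of the product of the
    ['X - z%:P] over the earlier nodes, which vanishes at those nodes but not at [y]. *)
Lemma poly_interpolation (F : fieldType) (s : seq F) (f : F -> F) :
  exists p : {poly F}, forall x, x \in s -> p.[x] = f x.
Proof.
elim: s => [|y s [p pP]]; first by exists 0.
have [ys|yNs] := boolP (y \in s).
  by exists p => x; rewrite inE => /orP[/eqP->|]; exact: pP.
pose w := \prod_(z <- s) ('X - z%:P).
have wy : w.[y] != 0 by move: yNs; rewrite -root_prod_XsubC.
exists (p + ((f y - p.[y]) / w.[y])%:P * w) => x.
rewrite !hornerE inE => /orP[/eqP->|xs]; first by rewrite divfK // addrC subrK.
by have /rootP-> : root w x; rewrite ?root_prod_XsubC // mulr0 addr0 pP.
Qed.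

(** * Conjugate transposes of matrices and of matrix spaces *)

Section Adjoint.

Variable C : numClosedFieldType.

Lemma adjmx0 m n : (0 : 'M[C]_(m, n))^t* = 0.
Proof. by rewrite trmx0 map_mx0. Qed.

Lemma adjmxM m n p (A : 'M[C]_(m, n)) (B : 'M[C]_(n, p)) :
  (A *m B)^t* = B^t* *m A^t*.
Proof. by rewrite trmx_mul map_mxM. Qed.

Lemma adjmx_lin m n (a : C) (A B : 'M[C]_(m, n)) :
  (a *: A + B)^t* = a^* *: A^t* + B^t*.
Proof. by rewrite linearP map_mxD map_mxZ. Qed.

Lemma adjmx_sum m n I (r : seq I) (P : pred I) (A : I -> 'M[C]_(m, n)) :
  (\sum_(i <- r | P i) A i)^t* = \sum_(i <- r | P i) (A i)^t*.
Proof. by rewrite raddf_sum raddf_sum. Qed.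

Lemma adjmx_diag n (d : 'rV[C]_n) : (diag_mx d)^t* = diag_mx (map_mx Num.conj d).
Proof. by rewrite tr_diag_mx map_diag_mx. Qed.

Lemma gram_diag m n (A : 'M[C]_(m, n)) (j : 'I_n) :
  (A^t* *m A) j j = \sum_i `|A i j| ^+ 2.
Proof. by rewrite mxE; apply: eq_bigr => i _; rewrite !mxE normCKC. Qed.

Lemma adjmx_mxcol_mxblock k n p (v : 'I_k -> 'M[C]_(n, p))
    (M : 'I_k -> 'I_k -> 'M[C]_n) :
  (\mxcol_i v i)^t* *m \mxblock_(i < k, j < k) M i j *m \mxcol_i v i =
  \sum_i \sum_j (v i)^t* *m M i j *m v j.
Proof.
rewrite tr_mxcol; have -> : map_mx Num.conj (\mxrow_i (v i)^T) = \mxrow_i (v i)^t*.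
  by apply/matrixP=> i j; rewrite !mxE.
rewrite mul_mxrow_mxblock mul_mxrow_mxcol exchange_big /=.
by apply: eq_bigr => j _; rewrite mulmx_suml.
Qed.

(** Taking adjoints is conjugate-linear, so this space is not the image of [X] under a linear map;
    it is spanned by the adjoints of a basis instead. *)
Definition adjoint_vspace m n (X : {vspace 'M[C]_(m, n)}) : {vspace 'M[C]_(n, m)} :=
  <<[seq x^t* | x <- vbasis X]>>%VS.

Lemma mem_adjoint_vspace m n (X : {vspace 'M[C]_(m, n)}) y :
  (y \in adjoint_vspace X) = (y^t* \in X).
Proof.
apply/idP/idP => [|yX].
  move: y; apply: span_ind => [|a u v uX vX|_ /mapP[x xX ->]].
  - by rewrite adjmx0 mem0v.
  - by rewrite adjmx_lin memvD ?memvZ.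
  - by rewrite trmxCK vbasis_mem.
rewrite -[y]trmxCK; move: (y^t*) yX; apply: vbasis_ind => [|a u v uX vX|x xX].
- by rewrite adjmx0 mem0v.
- by rewrite adjmx_lin memvD ?memvZ.
- by apply/memv_span/map_f.
Qed.

End Adjoint.

(** * Inverse square roots by polynomial functional calculus *)

Section InverseSquareRoot.

Variables (C : numClosedFieldType) (n : nat) (P : 'M[C]_n).

Hypothesis P_normal : P \is normalmx.

Let U := spectralmx P.
Let d := spectral_diag P.

Let UV : U *m U^t* = 1%:M.
Proof. exact/unitarymxP/spectral_unitarymx. Qed.

Let UV' : U^t* *m U = 1%:M.
Proof. exact: mulmx1C UV. Qed.

Let PE : P = U^t* *m diag_mx d *m U.
Proof.
by rewrite {1}(orthomx_spectralP P_normal) invmx_unitary ?spectral_unitarymx.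
Qed.

(* The value [p(P)]; [horner_mx] is only available in size [n.+1]. *)
Let fc (p : {poly C}) : 'M[C]_n := U^t* *m diag_mx (map_mx (horner p) d) *m U.

(** Horner's scheme: [fc (p * 'X + c%:P)] is [fc p *m P + c%:M], and both right multiplication by
    [P] and scaling preserve [X]. *)
Let fc_stable m (X : {vspace 'M[C]_(m, n)}) p :
  (forall x, x \in X -> x *m P \in X) -> forall x, x \in X -> x *m fc p \in X.
Proof.
move=> XP; elim/poly_ind: p => [|p c IHp] x xX.
  have -> : fc 0 = 0.
    rewrite /fc (_ : map_mx (horner 0) d = 0) ?linear0 ?mulmx0 ?mul0mx //.
    by apply/rowP=> i; rewrite !mxE horner0.
  by rewrite mulmx0 mem0v.
have -> : fc (p * 'X + c%:P) = fc p *m P + c%:M.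
  rewrite PE /fc -!mulmxA [U *m (_ *m _)]mulmxA UV mul1mx !mulmxA.
  have -> : c%:M = U^t* *m c%:M *m U.
    by rewrite -mulmxA mul_scalar_mx -scalemxAr UV' scalemx1.
  rewrite -mulmxDl -[U^t* *m _ *m diag_mx d]mulmxA -mulmxDr; congr (_ *m _ *m _).
  by apply/matrixP=> i j; rewrite mulmx_diag !mxE !hornerE mulrnDl.
by rewrite mulmxDr mulmxA mul_mx_scalar memvD ?memvZ ?XP ?IHp.
Qed.

Lemma inverse_square_root :
    (forall i, 0 < d 0 i) ->
  exists Q : 'M[C]_n,
    [/\ Q^t* *m P *m Q = 1%:M,
        Q \in unitmx
      & forall m (X : {vspace 'M[C]_(m, n)}),
          (forall x, x \in X -> x *m P \in X) ->
          forall x, x \in X -> x *m Q \in X].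
Proof.
move=> d_gt0.
(* Only the values at the finitely many eigenvalues matter, so a polynomial can replace the inverse
   square root; this is what makes [fc_stable] applicable. *)
have [p pP] := poly_interpolation [seq d 0 i | i : 'I_n] (fun x => (sqrtC x)^-1).
pose e := map_mx (horner p) d.
have QPQ : (fc p)^t* *m P *m fc p = 1%:M.
  rewrite PE /fc -/e !adjmxM trmxCK adjmx_diag -!mulmxA.
  rewrite [U *m (_ *m _)]mulmxA UV mul1mx [U *m (_ *m _)]mulmxA UV mul1mx.
  rewrite !mulmxA -[X in X *m U]mulmxA -[X in X *m U]mulmxA !mulmx_diag.
  rewrite (_ : diag_mx _ = 1%:M) ?mulmx1 ?UV' //.
  apply/matrixP=> i j; rewrite !mxE; congr (_ *+ _).
  (* Positivity makes the root real and nonzero: conjugation disappears and the diagonal entry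
     reduces to 1. *)
  have s_gt0 : 0 < sqrtC (d 0 i) by rewrite sqrtC_gt0.
  rewrite pP ?image_f // conj_Creal ?realV ?gtr0_real // mulrA mulrC mulrA.
  by rewrite -invfM -expr2 sqrtCK mulVf ?gt_eqF.
exists (fc p); split=> //; first by have [] := mulmx1_unit QPQ.
by move=> m X; apply: fc_stable.
Qed.

End InverseSquareRoot.

(** * Kraus maps, and Kraus operators spanning a given TRO *)

Section Kraus.

Variables (C : numClosedFieldType) (n m : nat).

Section Map.

Variables (r : nat) (A : 'I_r -> 'M[C]_(m, n)).

Definition kraus_map (M : 'M[C]_m) : 'M[C]_n := \sum_(i < r) (A i)^t* *m M *m A i.

Lemma kraus_map_is_linear : linear kraus_map.
Proof.
move=> a M N; rewrite /kraus_map scaler_sumr -big_split; apply: eq_bigr => i _.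
by rewrite mulmxDr mulmxDl -scalemxAr -scalemxAl.
Qed.

HB.instance Definition _ :=
  GRing.isLinear.Build C _ _ _ kraus_map kraus_map_is_linear.

(** The quadratic form of the image block matrix at [v] is the sum over [l] of the form of the
    original block matrix at the stacked vectors [A l *m v i]. *)
Lemma kraus_map_cp : completely_positive kraus_map.
Proof.
move=> k T Tpos x; rewrite -[x]submxcolK; set v := submxcol x.
rewrite adjmx_mxcol_mxblock.
have -> : \sum_i \sum_j (v i)^t* *m kraus_map (T i j) *m v j =
    \sum_l \sum_i \sum_j (A l *m v i)^t* *m T i j *m (A l *m v j).
  rewrite [RHS]exchange_big /=; apply: eq_bigr => i _.
  rewrite [RHS]exchange_big /=; apply: eq_bigr => j _.
  rewrite mulmx_sumr mulmx_suml; apply: eq_bigr => l _.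
  by rewrite adjmxM !mulmxA.
rewrite summxE sumr_ge0 // => l _.
by rewrite -adjmx_mxcol_mxblock; apply: Tpos.
Qed.

Lemma kraus_cohomomorphism (S : {vspace 'M[C]_n}) (T : {vspace 'M[C]_m}) :
  \sum_(i < r) (A i)^t* *m A i = 1%:M ->
  (forall i j M, M \in T -> (A i)^t* *m M *m A j \in S) ->
  cohomomorphism_via T S kraus_map A.
Proof.
move=> A1 AT; split=> //; last exact: kraus_map_cp.
by rewrite /= /kraus_map -[RHS]A1; apply: eq_bigr => i _; rewrite mulmx1.
Qed.

End Map.

(** Used twice: on [X] it supplies the operators [A] of a bicohomomorphism, on the adjoint of [X]
    the adjoints of the operators [B]. *)
Lemma kraus_frame (X : {vspace 'M[C]_(m, n)}) :
    in_span (fun M => exists a b, [/\ a \in X, b \in X & M = a^t* *m b]) 1%:M ->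
    is_TRO X ->
  exists r (A : 'I_r -> 'M[C]_(m, n)),
    \sum_(i < r) (A i)^t* *m A i = 1%:M /\ <<codom A>>%VS = X.
Proof.
move=> X1 troX; pose b := vbasis X; pose x (i : 'I_(\dim X)) := b`_i.
have xX i : x i \in X by rewrite vbasis_mem // mem_nth // size_tuple.
pose P := \sum_i (x i)^t* *m x i.
have Pherm : P^t* = P.
  by rewrite adjmx_sum; apply: eq_bigr => i _; rewrite adjmxM trmxCK.
have Pnormal : P \is normalmx by apply/normalmxP; rewrite Pherm.
set U := spectralmx P; set d := spectral_diag P.
have UV : U *m U^t* = 1%:M by exact/unitarymxP/spectral_unitarymx.
(* With [u] the i-th column of [U^t*], an eigenvector of [P], the eigenvalue is the sum over [k] of
   the squared norms of [x k *m u]. *)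
have dE i : d 0 i = \sum_k \sum_j `|(x k *m U^t*) j i| ^+ 2.
  transitivity ((U *m P *m U^t*) i i).
    rewrite (orthomx_spectralP Pnormal) invmx_unitary ?spectral_unitarymx //.
    rewrite -/U -/d !mulmxA UV mul1mx -mulmxA UV mulmx1.
    by rewrite mxE eqxx mulr1n.
  rewrite mulmx_sumr mulmx_suml summxE; apply: eq_bigr => k _.
  by rewrite -gram_diag adjmxM trmxCK !mulmxA.
have d_gt0 i : 0 < d 0 i.
  have sq_ge0 k j : 0 <= `|(x k *m U^t*) j i| ^+ 2 by rewrite exprn_ge0.
  rewrite lt_def dE !sumr_ge0 ?andbT => [|k _]; last exact: sumr_ge0.
  apply/negP => /eqP d0.
  (* A zero eigenvalue forces every [x k], hence all of [X], to kill [u]; then so does the identity,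
     as a combination of products [a^t* *m c], although [u] has norm 1. *)
  have xU k : col i (x k *m U^t*) = 0.
    have k0 : \sum_j `|(x k *m U^t*) j i| ^+ 2 = 0.
      by apply: psumr_eq0P d0 k isT => l _; apply: sumr_ge0.
    apply/colP=> j; rewrite mxE [RHS]mxE; apply/normr0_eq0/eqP.
    by rewrite -sqrf_eq0; apply/eqP; move: j isT; apply: psumr_eq0P k0.
  have XU y : y \in X -> col i (y *m U^t*) = 0.
    move: y; apply: vbasis_ind => [|a u v u0 v0|y].
    - by rewrite mul0mx linear0.
    - by rewrite mulmxDl -scalemxAl linearP /= u0 v0 scaler0 addr0.
    - move=> /(nthP 0)[k]; rewrite size_tuple => k_lt <-.
      exact: (xU (Ordinal k_lt)).
  have U0 : col i (U^t*) = 0.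
    rewrite -[U^t*]mul1mx; move: 1%:M X1; apply: in_span_ind => [|a u v u0 v0|].
    - by rewrite mul0mx linear0.
    - by rewrite mulmxDl -scalemxAl linearP /= u0 v0 scaler0 addr0.
    - by move=> _ [a [c [_ cX ->]]]; rewrite -mulmxA colE -mulmxA -colE XU // mulmx0.
  have /matrixP/(_ i i) := UV.
  have -> : (U *m U^t*) i i = (U *m col i (U^t*)) i 0.
    by rewrite !mxE; apply: eq_bigr => j _; rewrite !mxE.
  by rewrite U0 mulmx0 !mxE eqxx => /esym/eqP; rewrite oner_eq0.
have [Q [QPQ Qunit QX]] := inverse_square_root Pnormal d_gt0.
(* Each term of [y *m P] is a triple product of elements of [X]. *)
have XP y : y \in X -> y *m P \in X.
  by move=> yX; rewrite mulmx_sumr memv_suml // => i _; rewrite mulmxA troX.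
exists (\dim X), (fun i => x i *m Q); split.
  rewrite -[RHS]QPQ mulmx_sumr mulmx_suml; apply: eq_bigr => i _.
  by rewrite adjmxM !mulmxA.
apply/eqP; rewrite eqEdim; apply/andP; split.
  apply/span_subvP => _ /codomP[i ->]; exact: QX.
(* Right multiplication by the invertible [Q] is injective, so the image of [X] has the dimension of
   [X]. *)
suff -> : <<codom (fun i => x i *m Q)>>%VS = (linfun (mulmxr Q) @: X)%VS.
  rewrite limg_dim_eq //; apply/eqP; rewrite -subv0.
  apply/subvP=> y; rewrite memv_cap memv_ker lfunE /= => /andP[_ /eqP yQ].
  by rewrite memv0 -[y](mulmxK Qunit) yQ mul0mx.
rewrite -[in RHS](span_basis (vbasisP X)) limg_span; apply: eq_span => y.
apply/codomP/mapP => [[i ->]|[z /(nthP 0)[k]]].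
  by exists (x i); rewrite ?lfunE // mem_nth // size_tuple.
by rewrite size_tuple => k_lt <- ->; exists (Ordinal k_lt); rewrite lfunE.
Qed.

End Kraus.

(** * The implications between the three equivalences *)

Section Equivalences.

Variables (C : numClosedFieldType) (n m : nat).
Variables (S : {vspace 'M[C]_n}) (T : {vspace 'M[C]_m}).

Lemma bicohomomorphic_bihom :
  bicohomomorphic S T -> bihomomorphically_equivalent S T.
Proof.
move=> [Phi [Psi [r [r' [A [B [[Phi1 _ PhiE AT] [Psi1 _ PsiE BS] AB]]]]]]].
have memA i : A i \in <<codom A>>%VS by apply/memv_span/codom_f.
have memB i : B i \in <<codom A>>%VS by rewrite AB; apply/memv_span/codom_f.
exists <<codom A>>%VS; split; first split.
- exists (codom (fun i => (A i)^t* *m A i)) => [_ /codomP[i ->]|].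
    by exists (A i), (A i).
  (* Unitality of [Phi] writes the identity as the sum of the [(A i)^t* *m A i]. *)
  rewrite -Phi1 PhiE; apply: memv_suml => i _; rewrite mulmx1.
  by apply/memv_span/codomP; exists i.
- exists (codom (fun i => B i *m (B i)^t*)) => [_ /codomP[i ->]|].
    by exists (B i), (B i).
  rewrite -Psi1 PsiE; apply: memv_suml => i _; rewrite mulmx1 trmxCK.
  by apply/memv_span/codomP; exists i.
- move=> a b t aX bX tT; move: a aX; apply: span_ind => [|c u v uS vS|].
  + by rewrite adjmx0 !mul0mx mem0v.
  + by rewrite adjmx_lin !mulmxDl -!scalemxAl memvD ?memvZ.
  move=> _ /codomP[i ->]; move: b bX; apply: span_ind => [|c u v uS vS|].
  + by rewrite mulmx0 mem0v.
  + by rewrite mulmxDr -scalemxAr memvD ?memvZ.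
  by move=> _ /codomP[j ->]; apply: AT.
- rewrite AB => a b s aX bX sS; move: a aX; apply: span_ind => [|c u v uS vS|].
  + by rewrite !mul0mx mem0v.
  + by rewrite !mulmxDl -!scalemxAl memvD ?memvZ.
  move=> _ /codomP[i ->]; move: b bX; apply: span_ind => [|c u v uS vS|].
  + by rewrite adjmx0 mulmx0 mem0v.
  + by rewrite adjmx_lin mulmxDr -scalemxAr memvD ?memvZ.
  by move=> _ /codomP[j ->]; have := BS i j s sS; rewrite trmxCK.
Qed.

Lemma TRO_bicohomomorphic : TRO_equivalent S T -> bicohomomorphic S T.
Proof.
move=> [X [[X1 X1'] XT XS] troX].
have [r [A [A1 AX]]] := kraus_frame X1 troX.
have memA i : A i \in X by rewrite -AX; apply/memv_span/codom_f.
have [||r' [B [B1 BX]]] := @kraus_frame C m n (adjoint_vspace X).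
- case: X1' => s sX s1; exists s => // M /sX[a [b [aX bX ->]]].
  by exists (a^t*), (b^t*); rewrite !mem_adjoint_vspace !trmxCK.
- by move=> a b c; rewrite !mem_adjoint_vspace !adjmxM mulmxA => *; apply: troX.
have memB i : (B i)^t* \in X.
  by rewrite -mem_adjoint_vspace -BX; apply/memv_span/codom_f.
(* The frame [B] lies in the adjoint of [X], whereas [bicohomomorphic] wants operators in [X] and
   takes their adjoints as Kraus operators; hence the double adjoint. *)
exists (kraus_map A), (kraus_map (fun j => (B j)^t*^t*)), r, r', A.
exists (fun j => (B j)^t*); split.
- by apply: kraus_cohomomorphism => // i j M MT; exact: XT.
- apply: kraus_cohomomorphism => [|i j M MS]; last by rewrite (trmxCK (B i)); exact: XS.
  by rewrite -[RHS]B1; apply: eq_bigr => i _; rewrite (trmxCK (B i)).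
rewrite AX; apply/eqP; rewrite eqEsubv; apply/andP; split; last first.
  by apply/span_subvP => _ /codomP[i ->].
apply/subvP => y; rewrite -[y]trmxCK -mem_adjoint_vspace -BX.
move: (y^t*); apply: span_ind => [|c u v uX vX|_ /codomP[i ->]].
- by rewrite adjmx0 mem0v.
- by rewrite adjmx_lin memvD ?memvZ.
- by apply/memv_span/codomP; exists i.
Qed.

(** * The span of the triple products of a space *)

Section TripleProducts.

Variable X : {vspace 'M[C]_(m, n)}.

(** Products of basis vectors give a finite generating list; by (conjugate-)linearity in each factor
    they span all triple products. *)
Definition triple_vspace : {vspace 'M[C]_(m, n)} :=
  <<[seq ab *m c | ab <- [seq a *m b^t* | a <- vbasis X, b <- vbasis X],
                   c <- vbasis X]>>%VS.

Lemma mem_triple a b c :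
  a \in X -> b \in X -> c \in X -> a *m b^t* *m c \in triple_vspace.
Proof.
move=> aX bX cX; move: a aX; apply: vbasis_ind => [|k u v uY vY|a aX].
- by rewrite !mul0mx mem0v.
- by rewrite !mulmxDl -!scalemxAl memvD ?memvZ.
move: b bX; apply: vbasis_ind => [|k u v uY vY|b bX].
- by rewrite adjmx0 mulmx0 mul0mx mem0v.
- by rewrite adjmx_lin mulmxDr -scalemxAr mulmxDl -scalemxAl memvD ?memvZ.
move: c cX; apply: vbasis_ind => [|k u v uY vY|c cX].
- by rewrite mulmx0 mem0v.
- by rewrite mulmxDr -scalemxAr memvD ?memvZ.
by apply/memv_span/allpairs_f => //; apply: allpairs_f.
Qed.

Lemma triple_ind (Q : 'M[C]_(m, n) -> Prop) :
    Q 0 -> (forall k u v, Q u -> Q v -> Q (k *: u + v)) ->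
    (forall a b c, a \in X -> b \in X -> c \in X -> Q (a *m b^t* *m c)) ->
  forall y, y \in triple_vspace -> Q y.
Proof.
move=> Q0 Qlin QX; apply: span_ind => // y.
by case/allpairsP=> -[_ c] /= [/allpairsP[[a b] /= [aX bX ->]] cX ->];
  apply: QX; apply: vbasis_mem.
Qed.

Hypothesis impX : bihom_implementing S T X.

Lemma sub_triple : (X <= triple_vspace)%VS.
Proof.
have [[X1 _] _ _] := impX; apply/subvP => x xX.
rewrite -[x]mulmx1; move: 1%:M X1.
apply: in_span_ind => [|k u v uY vY|_ [a [b [aX bX ->]]]].
- by rewrite mulmx0 mem0v.
- by rewrite mulmxDr -scalemxAr memvD ?memvZ.
by rewrite mulmxA mem_triple.
Qed.

Lemma bihom_implementing_triple : bihom_implementing S T triple_vspace.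
Proof.
have [[[s sX s1] [s' sX' s1']] XT XS] := impX.
have XY := subvP sub_triple.
split; first split.
- by exists s => // M /sX[a [b [aX bX ->]]]; exists a, b; rewrite !XY.
- by exists s' => // M /sX'[a [b [aX bX ->]]]; exists a, b; rewrite !XY.
- move=> y z t yY zY tT; move: y yY.
  apply: triple_ind => [|k u v uS vS|a b c aX bX cX].
  + by rewrite adjmx0 !mul0mx mem0v.
  + by rewrite adjmx_lin !mulmxDl -!scalemxAl memvD ?memvZ.
  move: z zY.
  apply: triple_ind => [|k u v uS vS|a' b' c' aX' bX' cX'].
  + by rewrite mulmx0 mem0v.
  + by rewrite mulmxDr -scalemxAr memvD ?memvZ.
  (* Peeling the two triple products from the inside out, [t] travels from [T] to [S], back to [T],
     and ends in [S]. *)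
  have := XT _ _ _ cX cX' (XS _ _ _ bX bX' (XT _ _ _ aX aX' tT)).
  by rewrite !adjmxM trmxCK !mulmxA.
- move=> y z t yY zY tS; move: y yY.
  apply: triple_ind => [|k u v uS vS|a b c aX bX cX].
  + by rewrite !mul0mx mem0v.
  + by rewrite !mulmxDl -!scalemxAl memvD ?memvZ.
  move: z zY.
  apply: triple_ind => [|k u v uS vS|a' b' c' aX' bX' cX'].
  + by rewrite adjmx0 mulmx0 mem0v.
  + by rewrite adjmx_lin mulmxDr -scalemxAr memvD ?memvZ.
  (* Here the path runs from [S] to [T], back to [S], and ends in [T]. *)
  have := XS _ _ _ aX aX' (XT _ _ _ bX bX' (XS _ _ _ cX cX' tS)).
  by rewrite !adjmxM trmxCK !mulmxA.
Qed.

End TripleProducts.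

Lemma bihom_TRO : bihomomorphically_equivalent S T -> TRO_equivalent S T.
Proof.
move=> [X impX].
(* Induction on the codimension of [X]: unless [X] is already a TRO, passing to [triple_vspace X]
   strictly increases the dimension. *)
have [k] := ubnP (\dim {: 'M[C]_(m, n)} - \dim X).
elim: k X impX => // k IHk X impX; rewrite ltnS => dim_le.
have [YX|YX] := boolP (triple_vspace X <= X)%VS.
  by exists X => // a b c aX bX cX; apply: (subvP YX); apply: mem_triple.
apply: IHk (bihom_implementing_triple impX) _.
have dim_lt : (\dim X < \dim (triple_vspace X))%N.
  rewrite ltn_neqAle dimvS ?sub_triple // andbT.
  apply: contraNneq YX => dimE.
  suff /eqP<- : X == triple_vspace X by exact: subvv.
  by rewrite eqEdim sub_triple //= dimE.
apply: leq_trans dim_le; rewrite ltn_sub2l //.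
by apply: leq_trans dim_lt _; rewrite dimvS // subvf.
Qed.

End Equivalences.

Theorem proposition7p2 (R : realType) (n m : nat)
  (S : {vspace 'M[complex R]_n}) (T : {vspace 'M[complex R]_m})
  (hS : noncommutative_graph S) (hT : noncommutative_graph T) :
  (bicohomomorphic S T <-> bihomomorphically_equivalent S T) /\
  (bihomomorphically_equivalent S T <-> TRO_equivalent S T).
Proof.
split; split.
- exact: bicohomomorphic_bihom.
- by move=> /bihom_TRO; apply: TRO_bicohomomorphic.
- exact: bihom_TRO.
- by move=> [X impX _]; exists X.
Qed.
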